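(* Let $p$ be a prime, let $G$ be a finite group, and let $P\in\mathrm{Syl}_p(G)$. Then $G$ is $p$-nilpotent if and only if $N_G(P)$ is $p$-nilpotent and $\Phi(P)$ is strongly closed in $P$ with respect to $G$.
   Context: $\Phi(P)$ denotes the Frattini subgroup of $P$. For subgroups $K\le H$ of a finite group $G$, $K$ is called strongly closed in $H$ with respect to $G$ if $K^G\cap H\le K$, where $K^G$ denotes the set of all $G$-conjugates of elements of $K$; that is, whenever $x\in K$, $g\in G$ and $g^{-1}xg\in H$, then $g^{-1}xg\in K$. A finite group is $p$-nilpotent if it has a normal $p$-complement. *)

(* Defs.v *)
From mathcomp Require Import all_boot all_fingroup all_solvable.

Set Implicit Arguments.
Unset Strict Implicit.
Unset Printing Implicit Defensive.

Local Open Scope group_scope.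

(* A p-complement of G is a subgroup of p'-order and p-power index, i.e. a
   Hall p'-subgroup. *)
Definition p_nilpotent (gT : finGroupType) (p : nat) (G : {group gT}) : Prop :=
  exists2 K : {group gT}, K <| G & p^'.-Hall(G) K.

(* class_support K G is the set K^G of all conjugates x ^ g = g^-1 * (x * g)
   with x in K and g in G.  The notion is intended for K <= H <= G. *)
Definition strongly_closed (gT : finGroupType) (K H G : {group gT}) : Prop :=
  class_support K G :&: H \subset K.

(* Main.v *)
Require Import Defs.
From mathcomp Require Import all_boot all_fingroup all_solvable.
From mathcomp Require Import ssralg.

(** For the nontrivial direction write T = 'Phi(P).

    First, fusion in P is trivial modulo T: [~ x, g] lies in T whenever x and
    x ^ g lie in P.  This is an Alperin-style descending induction on subgroups
    Q of P with Q :^ g in P.  If T is contained in Q then g normalises T, and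
    Burnside's fusion argument applies to 'N_G(T) / T, whose Sylow subgroup
    P / T is abelian and centralised by its normaliser.  Otherwise one may
    assume that Q is fully normalised; the Frattini argument applied to the
    centraliser C of Q / (Q :&: T) in 'N_G(Q) reduces to elements normalising
    Q * (P :&: C), which is strictly larger because it contains 'N_T(Q).

    The transfer G -> P / T then has a kernel K with P :&: K in T, so G / K is
    a p-group, and G is p-nilpotent by a theorem of Tate.  For the latter, let
    L be minimal among normal subgroups with p-group quotient, S = P :&: L and
    R = [~: S, P].  The pullback to G of the central extension P / R of
    P / S = G / L splits over P, hence over G by Gaschutz; as L has no
    nontrivial p-quotient invariant under G, the splitting shows that P / R
    splits over S / R.  Since S is contained in 'Phi(P), this forces S = R,
    whence S = 1 by nilpotence of P. *)

Set Implicit Arguments.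
Unset Strict Implicit.
Unset Printing Implicit Defensive.

Import FiniteModule.
Local Open Scope group_scope.

(** * Commutator identities and consequences of p-nilpotence *)

Lemma commMg_act (gT : finGroupType) (x g h : gT) :
  [~ x, g * h] = [~ x, g] * [~ x ^ g, h].
Proof. by rewrite !commgEl -mulgA mulKVg conjgM. Qed.

Lemma commgV_act (gT : finGroupType) (x g : gT) :
  [~ x ^ g, g^-1] = [~ x, g]^-1.
Proof. by rewrite !commgEl conjgK [RHS]invMg invgK. Qed.

Lemma mem_commg_conj (gT : finGroupType) (A : {group gT}) (x g : gT) :
  x \in A -> ([~ x, g] \in A) = (x ^ g \in A).
Proof. by move=> Ax; rewrite commgEl groupMl ?groupV. Qed.

Lemma p_nilpotentS (gT : finGroupType) (p : nat) (G H : {group gT}) :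
  H \subset G -> p_nilpotent p G -> p_nilpotent p H.
Proof.
move=> sHG [K nsKG hallK]; exists (K :&: H)%G.
  by rewrite /= setIC; apply: normalGI nsKG.
exact: setI_normal_Hall nsKG hallK sHG.
Qed.

Lemma p_complement_mul_Sylow (gT : finGroupType) (p : nat) (G P K : {group gT}) :
  p.-Sylow(G) P -> K <| G -> p^'.-Hall(G) K -> K * P = G.
Proof.
move=> sylP nsKG hallK.
apply/eqP; rewrite eqEcard mulG_subG (normal_sub nsKG) (pHall_sub sylP) /=.
rewrite coprime_cardMg ?(pnat_coprime (pHall_pgroup sylP)) //.
  by rewrite (card_Hall hallK) (card_Hall sylP) mulnC partnC.
rewrite coprime_sym.
exact: pnat_coprime (pHall_pgroup sylP) (pHall_pgroup hallK).
Qed.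

(** Write [g = u * k] with [u] in [P] and [k] in [K]. Then [[~ x ^ u, k]] lies in [P :&: K], which
    is trivial, so [x ^ g = x ^ u] stays in [T]. *)
Lemma p_nilpotent_strongly_closed (gT : finGroupType) (p : nat)
    (G P T : {group gT}) :
  p.-Sylow(G) P -> T <| P -> p_nilpotent p G -> strongly_closed T P G.
Proof.
move=> sylP /andP[sTP nTP] [K nsKG hallK].
have defG := p_complement_mul_Sylow sylP nsKG hallK.
have nKP: P \subset 'N(K) := subset_trans (pHall_sub sylP) (normal_norm nsKG).
apply/subsetP=> _ /setIP[/imset2P[x g Tx Gg ->] Pxg].
have: g \in P * K by rewrite (normC nKP) defG.
case/mulsgP=> u k Pu Kk def_g; rewrite def_g conjgM in Pxg *.
have Ty: x ^ u \in T by rewrite memJ_norm // (subsetP nTP).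
have Py := subsetP sTP _ Ty.
suff: [~ x ^ u, k] \in P :&: K.
  rewrite coprime_TIg; last first.
    exact: pnat_coprime (pHall_pgroup sylP) (pHall_pgroup hallK).
  by move/set1P; rewrite commgEl => /(canRL (mulKVg _)) ->; rewrite mulg1.
rewrite inE mem_commg_conj // Pxg commgEr groupM //.
by rewrite memJ_norm ?groupV // (subsetP nKP).
Qed.

(** [[~: K, P]] lies in both [K] and [P], hence is trivial. As [N = K * P], only [[~: P, P]]
    remains, and [P / 'Phi(P)] is abelian. *)
Lemma p_nilpotent_norm_comm (gT : finGroupType) (p : nat) (P N : {group gT}) :
  p.-Sylow(N) P -> P <| N -> p_nilpotent p N -> [~: N, P] \subset 'Phi(P).
Proof.
move=> sylP nsPN [K nsKN hallK].
have pP := pHall_pgroup sylP.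
have sKP1: [~: K, P] \subset 'Phi(P).
  apply: subset_trans (sub1G _).
  rewrite -(coprime_TIg (pnat_coprime pP (pHall_pgroup hallK))).
  rewrite subsetI commg_subr commg_subl.
  rewrite (subset_trans (normal_sub nsKN) (normal_norm nsPN)).
  exact: subset_trans (normal_sub nsPN) (normal_norm nsKN).
rewrite -(p_complement_mul_Sylow sylP nsKN hallK).
have nPhi: N \subset 'N('Phi(P)).
  exact: char_norm_trans (Phi_char P) (normal_norm nsPN).
have nPhiP: P \subset 'N('Phi(P)) := normal_norm (Phi_normal P).
have nPhiK := subset_trans (normal_sub nsKN) nPhi.
rewrite -quotient_cents2 ?mul_subG // quotientMl // mul_subG //.
  by rewrite quotient_cents2.
exact: abelem_abelian (Phi_quotient_abelem pP).
Qed.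

(** * Burnside fusion for an abelian Sylow subgroup, and modulo [T] *)

(** Both [S] and [S :^ g] are Sylow in the centraliser of [x ^ g], so some [c] there makes [g * c]
    normalise, hence centralise, [S]. *)
Lemma abelian_Sylow_fusion (gT : finGroupType) (p : nat) (G S : {group gT}) x g :
  p.-Sylow(G) S -> abelian S -> 'N_G(S) \subset 'C(S) ->
  x \in S -> g \in G -> x ^ g \in S -> x ^ g = x.
Proof.
move=> sylS cSS cNS Sx Gg Sxg; have sSG := pHall_sub sylS.
pose C := 'C_G[x ^ g]%G.
have sSC: S \subset C.
  by rewrite subsetI sSG sub_cent1 (subsetP cSS).
have sSgC: S :^ g \subset C.
  by rewrite subsetI conj_subG //= cent1J conjSg sub_cent1 (subsetP cSS).
have sylSC: p.-Sylow(C) S := pHall_subl sSC (subsetIl _ _) sylS.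
have sylSgC: p.-Sylow(C) (S :^ g).
  by rewrite (pHall_subl sSgC (subsetIl _ _)) // pHallJ.
have [c /setIP[Gc cxc] defS] := Sylow_trans sylSgC sylSC.
have Nn: g * c \in 'N_G(S).
  by rewrite inE groupM //=; apply/normP; rewrite conjsgM -defS.
have /cent1P/esym/commgP/conjg_fixP := cxc; rewrite -conjgM => fx.
rewrite -fx; apply/conjg_fixP/commgP/esym.
exact: (centP (subsetP cNS _ Nn)).
Qed.

Lemma norm_abelian_quotient_fusion (gT : finGroupType) (p : nat)
    (G P T : {group gT}) x g :
  p.-Sylow(G) P -> T <| P -> [~: 'N_G(P), P] \subset T ->
  x \in P -> g \in 'N_G(T) -> x ^ g \in P -> [~ x, g] \in T.
Proof.
move=> sylP /andP[sTP nTP] sNPT Px NTg Pxg.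
have sPN: P \subset 'N_G(T) by rewrite subsetI (pHall_sub sylP).
have sylPN: p.-Sylow('N_G(T)) P := pHall_subl sPN (subsetIl _ _) sylP.
have nTN: 'N_G(T) \subset 'N(T) := subsetIr _ _.
have nT := subsetP nTN.
have cPT: P / T \subset 'C(P / T).
  rewrite quotient_cents2 //; apply: subset_trans sNPT.
  by rewrite commSg // subsetI (pHall_sub sylP) normG.
have sylQ: p.-Sylow('N_G(T) / T) (P / T) by apply: quotient_pHall.
have cNQ: 'N_('N_G(T) / T)(P / T) \subset 'C(P / T).
  rewrite -quotient_subnormG; last by rewrite /normal sTP.
  have sNN: 'N_('N_G(T))(P) \subset 'N(T) by rewrite subIset ?nTN.
  rewrite quotient_cents2 //.
  by apply: subset_trans sNPT; rewrite commSg // setSI // subsetIl.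
have := abelian_Sylow_fusion sylQ cPT cNQ (mem_quotient T Px)
  (mem_quotient T NTg).
have [nTx nTg] := (nT x (subsetP sPN _ Px), nT g NTg).
rewrite -morphJ //= mem_quotient // => /(_ isT) eq_xg.
apply: coset_idr; first by rewrite groupR.
by rewrite morphR //=; apply/eqP/conjg_fixP; rewrite -morphJ.
Qed.

(** * Triviality of fusion in [P] modulo a strongly closed [T] *)

Section StronglyClosedFusion.

Variables (gT : finGroupType) (p : nat) (G P T : {group gT}).
Hypotheses (sylP : p.-Sylow(G) P) (nsTP : T <| P).
Hypothesis scT : strongly_closed T P G.
Hypothesis fusN :
  forall x g, x \in P -> g \in 'N_G(T) -> x ^ g \in P -> [~ x, g] \in T.

Implicit Types Q R : {group gT}.

Let sPG := pHall_sub sylP.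
Let pP := pHall_pgroup sylP.

Lemma strongly_closed_mem x g : x \in T -> g \in G -> x ^ g \in P -> x ^ g \in T.
Proof.
by move=> Tx Gg Pxg; apply: (subsetP scT); rewrite inE Pxg imset2_f.
Qed.

Lemma fusion_above Q g x :
  T \subset Q -> Q \subset P -> g \in G -> Q :^ g \subset P -> x \in Q ->
  [~ x, g] \in T.
Proof.
move=> sTQ sQP Gg sQgP Qx; apply: fusN; first exact: (subsetP sQP).
  rewrite inE Gg /= inE; apply/subsetP=> _ /imsetP[t Tt ->].
  apply: strongly_closed_mem => //; rewrite (subsetP sQgP) // memJ_conjg.
  exact: (subsetP sTQ).
by rewrite (subsetP sQgP) // memJ_conjg.
Qed.

Lemma proper_norm_Sylow Q : Q \proper P -> Q \proper 'N_P(Q).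
Proof. exact: nilpotent_proper_norm (pgroup_nil pP). Qed.

(** A Sylow subgroup [S] of ['N_G(Q)] containing ['N_P(Q)] is moved into [P] by some [h]; comparing
    orders, [S :^ h] is all of ['N_P(Q :^ h)]. *)
Lemma fully_normalized_conj Q : Q \subset P ->
  exists h, [/\ h \in G, Q :^ h \subset P
             & p.-Sylow('N_G(Q :^ h)) 'N_P(Q :^ h)].
Proof.
move=> sQP.
have sNN: 'N_P(Q) \subset 'N_G(Q) by rewrite setSI.
have [S sylS sNS] := Sylow_superset sNN (pgroupS (subsetIl P 'N(Q)) pP).
have sSG: S \subset G := subset_trans (pHall_sub sylS) (subsetIl _ _).
have [h Gh sShP] := Sylow_Jsub sylP sSG (pHall_pgroup sylS).
have sQS: Q \subset S by apply: subset_trans sNS; rewrite subsetI sQP normG.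
exists h; split=> //; first by rewrite (subset_trans _ sShP) ?conjSg.
have sylSh: p.-Sylow('N_G(Q :^ h)) (S :^ h).
  by rewrite normJ -{1}(conjGid Gh) -conjIg pHallJ2.
suff -> : 'N_P(Q :^ h) = S :^ h by [].
have sShN: S :^ h \subset 'N_P(Q :^ h).
  rewrite subsetI sShP; exact: subset_trans (pHall_sub sylSh) (subsetIr _ _).
apply/esym/eqP; rewrite eqEcard sShN.
have sNN': 'N_P(Q :^ h) \subset 'N_G(Q :^ h) by rewrite setSI.
have [u _ sNu] := Sylow_subJ sylSh sNN' (pgroupS (subsetIl P 'N(Q :^ h)) pP).
by rewrite -(cardJg (S :^ h) u) subset_leq_card.
Qed.

Lemma commg_subnorm_setI R y t :
  R \subset P -> t \in 'N_T(R) -> y \in R -> [~ y, t] \in R :&: T.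
Proof.
move=> sRP /setIP[Tt Nt] Ry; have nTP := normal_norm nsTP.
rewrite inE mem_commg_conj // memJ_norm // Ry commgEr groupM //.
by rewrite memJ_norm ?groupV // (subsetP nTP) // (subsetP sRP).
Qed.

Lemma fully_normalized_fusion R :
    R \subset P -> ~~ (T \subset R) -> p.-Sylow('N_G(R)) 'N_P(R) ->
    (forall Q g x, R \proper Q -> Q \subset P -> g \in G -> Q :^ g \subset P ->
       x \in Q -> [~ x, g] \in T) ->
  forall m y, m \in 'N_G(R) -> y \in R -> [~ y, m] \in T.
Proof.
move=> sRP nsTR sylR IH m y Mm Ry.
have nTP := normal_norm nsTP; have sTP := normal_sub nsTP.
pose M := 'N_G(R)%G; pose T0 := (R :&: T)%G.
have nRM: M \subset 'N(R) := subsetIr _ _.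
have sMG: M \subset G := subsetIl _ _.
have nT0M: M \subset 'N(T0).
  apply/subsetP=> n Mn; rewrite inE; apply/subsetP=> _ /imsetP[z /setIP[Rz Tz] ->].
  have Rzn: z ^ n \in R by rewrite memJ_norm // (subsetP nRM).
  rewrite inE Rzn strongly_closed_mem ?(subsetP sMG) //.
  exact: (subsetP sRP).
have sRM: R \subset M by rewrite subsetI normG (subset_trans sRP).
(* [C] consists of the elements of [M] acting trivially on [R / T0]. *)
pose C := (M :&: coset T0 @*^-1 'C(R / T0))%G.
have memC c: c \in C -> {in R, forall z, [~ z, c] \in T0}.
  case/setIP=> Mc /morphpreP[Nc cRc] z Rz.
  have Nz: z \in 'N(T0) by rewrite (subsetP nT0M) // (subsetP sRM).
  apply: coset_idr; first by rewrite groupR.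
  rewrite morphR //; apply/eqP/commgP/esym.
  by apply: (centP cRc); rewrite mem_quotient.
have Cmem c: c \in M -> {in R, forall z, [~ z, c] \in T0} -> c \in C.
  move=> Mc cRc; have Nc := subsetP nT0M c Mc.
  rewrite inE Mc; apply/morphpreP; split=> //.
  apply/centP=> _ /morphimP[z Nz Rz ->]; apply/esym/commgP.
  by rewrite -morphR //= coset_id // cRc.
have nsCM: C <| M.
  rewrite /normal subsetIl normsI ?normG //.
  rewrite (subset_trans _ (morphpre_norm _ _)) // -sub_quotient_pre //.
  by rewrite norms_cent // quotient_norms.
pose D := ('N_P(R) :&: C)%G.
have sylD: p.-Sylow(C) D by have := Sylow_setI_normal nsCM sylR; rewrite setIC.
have sDP: D \subset P by rewrite /= -setIA subsetIl.
have nRD: D \subset 'N(R) by rewrite subIset // subsetIr.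
have sNTD: 'N_T(R) \subset D.
  rewrite subsetI setSI //=; apply/subsetP=> t Nt; apply: Cmem.
    by apply: subsetP Nt; rewrite setSI // (subset_trans sTP).
  by move=> z Rz; apply: commg_subnorm_setI.
(* If [D] were inside [R], so would be ['N_T(R)]; then [R] would be its own normaliser in the
   nilpotent group [R <*> T], forcing [T] into [R]. *)
have ltRD: R \proper R <*> D.
  rewrite properEneq joing_subl andbT; apply: contra nsTR => /eqP defR.
  have sNTR: 'N_T(R) \subset R.
    by apply: subset_trans sNTD _; rewrite defR joing_subr.
  have nTR: R \subset 'N(T) := subset_trans sRP nTP.
  have sRTP: R <*> T \subset P by rewrite join_subG sRP.
  have := nilpotent_sub_norm (pgroup_nil (pgroupS sRTP pP)) (joing_subl R T).
  rewrite /= {1}norm_joinEl // -group_modl ?normG // mulGSid // => <- //.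
  exact: joing_subr.
(* For [m = c * n], the factor [[~ y, c]] is in [T] by definition of [C]; the factor [[~ y ^ c, n]]
   falls under [IH], as [n] normalises the larger [R <*> D]. *)
have: m \in C * 'N_M(D) by rewrite (Frattini_arg nsCM sylD).
case/mulsgP=> c n Cc /setIP[Mn nDn] ->.
have /setIP[_ Tyc] := memC c Cc y Ry.
rewrite commMg_act groupM //; apply: (IH (R <*> D)%G) => //.
- by rewrite join_subG sRP.
- exact: (subsetP sMG).
- rewrite /= conjYg (normP nDn) (normP (subsetP nRM _ Mn)).
  by rewrite join_subG sRP.
rewrite /= mem_gen // inE memJ_norm ?Ry //.
by rewrite (subsetP nRM) // (subsetP (normal_sub nsCM)).
Qed.

Lemma strongly_closed_fusion x g :
  x \in P -> g \in G -> x ^ g \in P -> [~ x, g] \in T.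
Proof.
move=> Px Gg Pxg.
(* Induction on a bound for [#|P| - #|Q|] treats larger subgroups first; the claim is the case [Q =
   <[x]>]. *)
suff fusQ n Q h y: #|P| - #|Q| < n -> Q \subset P -> h \in G ->
    Q :^ h \subset P -> y \in Q -> [~ y, h] \in T.
- apply: (fusQ _ <[x]>%G _ _ (ltnSn _)); rewrite ?cycle_id ?cycle_subG //=.
  by rewrite -cycleJ cycle_subG.
elim: n => // n IHn in Q h y *; rewrite ltnS => leQn sQP Gh sQhP Qy.
have [sTQ | nsTQ] := boolP (T \subset Q); first exact: (fusion_above sTQ).
have [k [Gk sRP sylR]] := fully_normalized_conj sQP.
set R := (Q :^ k)%G in sRP sylR.
have IH Q' : #|Q| < #|Q'| -> Q' \subset P -> forall g' x', g' \in G ->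
    Q' :^ g' \subset P -> x' \in Q' -> [~ x', g'] \in T.
  move=> ltQ' sQ'P g' x' Gg' sQ'g Qx'; apply: (IHn Q') => //.
  apply: leq_trans leQn; rewrite ltn_sub2l //.
  exact: leq_trans ltQ' (subset_leq_card sQ'P).
have proper_sub Q' : #|Q'| = #|Q| -> Q' \subset P -> Q' \proper 'N_P(Q').
  move=> oQ' sQ'P; apply: proper_norm_Sylow; rewrite properEcard sQ'P oQ'.
  rewrite ltnNge; apply: contra nsTQ => lePQ.
  have /eqP -> : Q :==: P by rewrite eqEcard sQP.
  exact: normal_sub nsTP.
(* Sylow's theorem in ['N_G(R)] gives [m] moving ['N_P(Q') :^ l] into ['N_P(R)]. So [l * m] carries
   the strictly larger ['N_P(Q')] into [P], and [IH] applies. *)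
have toR Q' l : #|Q'| = #|Q| -> Q' \subset P -> l \in G -> Q' :^ l = R ->
    exists2 m, m \in 'N_G(R) & {in Q', forall z, [~ z, l * m] \in T}.
  move=> oQ' sQ'P Gl defR.
  have sNG: 'N_P(Q') :^ l \subset 'N_G(R).
    by rewrite conjIg subsetI -normJ defR subsetIr andbT subIset // conj_subG // sPG.
  have pN: p.-group ('N_P(Q') :^ l) by rewrite pgroupJ (pgroupS (subsetIl _ _) pP).
  have [m Nm sNm] := Sylow_Jsub sylR sNG pN.
  exists m => // z Qz; have [Gm _] := setIP Nm.
  apply: (IH 'N_P(Q')%G); rewrite ?groupM ?subsetIl //=.
  - by rewrite -oQ' proper_card ?proper_sub.
  - by rewrite conjsgM (subset_trans sNm) // subsetIl.
  by rewrite inE (subsetP sQ'P) // (subsetP (normG _)).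
have [m1 Nm1 fus1] := toR Q k erefl sQP Gk erefl.
have [m2 Nm2 fus2]: exists2 m, m \in 'N_G(R)
    & {in (Q :^ h)%G, forall z, [~ z, h^-1 * k * m] \in T}.
  apply: toR; rewrite ?cardJg ?groupM ?groupV //=.
  by rewrite conjsgM conjsgK.
have [Gm1 NRm1] := setIP Nm1; have [Gm2 NRm2] := setIP Nm2.
have Nm: m1^-1 * m2 \in 'N_G(R) by rewrite groupM ?groupV.
(* The three factors carry [Q] to [R], normalise [R], and carry [R] to [Q :^ h]; only the middle one
   is not yet controlled. *)
have defh: h = (k * m1) * ((m1^-1 * m2) * (h^-1 * k * m2)^-1).
  by rewrite !invMg invgK !mulgA !mulgK mulgV mul1g.
rewrite {1}defh commMg_act groupM ?fus1 //.
have Rz: y ^ (k * m1) \in R by rewrite conjgM memJ_norm // memJ_conjg.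
rewrite commMg_act groupM //; last first.
  have -> : (y ^ (k * m1)) ^ (m1^-1 * m2) = (y ^ h) ^ (h^-1 * k * m2).
    by rewrite -!conjgM !mulgA mulgK mulgV mul1g.
  by rewrite commgV_act groupV fus2 // memJ_conjg.
have [sTR | nsTR] := boolP (T \subset R).
  apply: (fusion_above sTR) => //; first by case/setIP: Nm.
  by case/setIP: Nm => _ /normP->.
apply: (fully_normalized_fusion sRP) Nm Rz => //.
move=> Q' g' x' ltRQ' sQ'P Gg' sQ'g Qx'; apply: (IH Q') => //.
by rewrite -(cardJg Q k) proper_card.
Qed.

End StronglyClosedFusion.

(** * Transfer into [P / T] *)

(** The cycle expansion gives the transfer of [x] in [P] as a product of conjugates of powers of
    [x]. Modulo [T] each equals the power itself, and the exponents add up to [#|G : P|], which is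
    prime to [p]. *)
Lemma transfer_kernel (gT : finGroupType) (p : nat) (G P T : {group gT}) :
  p.-Sylow(G) P -> T <| P -> abelian (P / T) ->
  (forall x g, x \in P -> g \in G -> x ^ g \in P -> [~ x, g] \in T) ->
  exists2 K : {group gT}, K <| G & p.-group (G / K) && (P :&: K \subset T).
Proof.
move=> sylP /andP[sTP nTP] cPT fusT; have [sPG pP p'iP] := and3P sylP.
pose alpha := restrm_morphism nTP (coset_morphism T).
have imalpha: alpha @* P = P / T by rewrite morphim_restrm setIid.
have cA: abelian (alpha @* P) by rewrite imalpha.
pose V := transfer_morphism G cA.
exists ('ker V)%G; first exact: ker_normal.
apply/andP; split.
  rewrite /pgroup (card_isog (first_isog V)) /=.
  have injf: 'injm (fmval_morphism cA) by apply/injmP=> u v _ _; apply: val_inj.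
  rewrite -(card_injm injf) ?subsetT //.
  apply: pgroupS (quotient_pgroup T pP).
  by rewrite /= -imalpha; apply/subsetP=> _ /morphimP[u _ _ ->]; apply: fmodP.
apply/subsetP=> x /setIP[Px /kerP Vx]; have Gx := subsetP sPG x Px.
have {}Vx: transfer G cA x = 0%R by exact: Vx.
have trX := transversalP (rcosets_cycle_partition sPG Gx).
set X := transversal _ _ in trX.
have sXG: X \subset G := transversal_sub trX.
have eq0: (fmod cA (alpha x) *+ #|G : P| = 0)%R.
  rewrite -Vx (transfer_cycle_expansion sPG cA Gx trX).
  rewrite -(sum_index_rcosets_cycle sPG Gx trX) -GRing.sumrMnr.
  apply: eq_bigr => y Xy; rewrite -[(_ *+ _)%R]morphX ?mem_morphim //=.
  rewrite -morphX //= /restrm; congr fmod.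
  have Pgx: (x ^+ #|<[x]> : P :* y|) ^ y^-1 \in P.
    by rewrite conjgE invgK mulgA -mem_rcoset mulg_exp_card_rcosets.
  set z := x ^+ _ in Pgx *; have Pz: z \in P by rewrite groupX.
  have Gy1: y^-1 \in G by rewrite groupV (subsetP sXG).
  have Tzy := fusT z y^-1 Pz Gy1 Pgx.
  have -> : z ^ y^-1 = z * [~ z, y^-1] by rewrite commgEl mulKVg.
  have nTz := subsetP nTP z Pz.
  by rewrite morphM ?(subsetP nTP _ (subsetP sTP _ Tzy)) //= (coset_id Tzy) mulg1.
have nTx := subsetP nTP x Px.
apply: coset_idr => //; apply/eqP; rewrite -order_eq1 -dvdn1.
have co: coprime #[coset T x] #|G : P|.
  apply: pnat_coprime p'iP; apply: (mem_p_elt (quotient_pgroup T pP)).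
  exact: mem_quotient.
rewrite -(Gauss_dvdl _ co) mul1n order_dvdn.
have := congr_fmod eq0; rewrite fmval0 fmvalZ fmodK ?mem_morphim //=.
by rewrite /restrm => ->.
Qed.

(** * Tate's theorem via a pullback extension and Gaschutz splitting *)

Section Tate.

Variables (gT : finGroupType) (p : nat) (G P L : {group gT}).
Hypotheses (sylP : p.-Sylow(G) P) (nsLG : L <| G) (pGL : p.-group (G / L)).
Hypothesis minL : forall K : {group gT},
  K <| G -> p.-group (G / K) -> K \subset L -> L \subset K.

Let S := (P :&: L)%G.
Let R := [~: S, P]%G.

Let sPG := pHall_sub sylP.
Let pP := pHall_pgroup sylP.
Let nLP : P \subset 'N(L) := subset_trans sPG (normal_norm nsLG).

Let defG : L * P = G.
Proof.
have sLPG: L * P \subset G by apply: mul_subG => //; apply: normal_sub.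
apply/eqP; rewrite eqEsubset sLPG -quotientSK ?normal_norm //.
have sylPL: p.-Sylow(G / L) (P / L).
  by rewrite quotient_pHall ?(subset_trans sPG) ?normal_norm.
by rewrite -(pHall_id sylPL pGL) subxx.
Qed.

Let nsSP : S <| P.
Proof. by have := normalGI sPG nsLG. Qed.

Let sRS : R \subset S.
Proof. by rewrite commg_subl normal_norm. Qed.

Let sRP : R \subset P.
Proof. exact: subset_trans sRS (normal_sub nsSP). Qed.

Let nRP : P \subset 'N(R).
Proof. by rewrite normsR ?normG ?normal_norm. Qed.

(** The graph of the quotient map modulo [R]; its image [D] is the copy of [P] that complements [Z1]
    in [Y]. *)
Let delta x := (x, coset R x).

Let deltaM : {in P &, {morph delta : x y / x * y}}.
Proof.
by move=> x y Px Py; rewrite /delta morphM ?(subsetP nRP).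
Qed.

Let delta_morphism := Morphism deltaM.

Let L1 := (@pairg1 gT (coset_of R) @* L)%G.
Let Z1 := (@pair1g gT (coset_of R) @* (S / R))%G.
Let D := (delta_morphism @* P)%G.
(* X is the pullback of G -> G / L = P / S and P / R -> P / S, and Y the part
   of X above P. *)
Let X := (L1 <*> D)%G.
Let Y := (Z1 <*> D)%G.

Let pairM a b c d :
  (a, b) * (c, d) = (a * c, b * d) :> gT * coset_of R.
Proof. by []. Qed.

Let L1P u : reflect (u.1 \in L /\ u.2 = 1) (u \in L1).
Proof.
apply: (iffP morphimP) => [[x _ Lx ->] // | [Lx u2]].
by exists u.1; rewrite ?inE //= /pairg1 -u2; case: u {Lx u2}.
Qed.

Let DP u : reflect (u.1 \in P /\ u.2 = coset R u.1) (u \in D).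
Proof.
apply: (iffP morphimP) => [[x _ Px ->] // | [Px u2]].
by exists u.1; rewrite ?inE //= /delta -u2; case: u {Px u2}.
Qed.

Let Z1P u : reflect (u.1 = 1 /\ u.2 \in S / R) (u \in Z1).
Proof.
apply: (iffP morphimP) => [[x _ Zx ->] // | [u1 Zu]].
by exists u.2; rewrite ?inE //= /pair1g -u1; case: u {Zu u1}.
Qed.

Let nL1D : D \subset 'N(L1).
Proof.
apply/subsetP=> u /DP[Pu1 _]; rewrite inE.
apply/subsetP=> _ /imsetP[v /L1P[Lv v2] ->].
apply/L1P; split.
  by rewrite (_ : (v ^ u).1 = v.1 ^ u.1) // memJ_norm // (subsetP nLP).
by rewrite (_ : (v ^ u).2 = v.2 ^ u.2) // v2 conj1g.
Qed.

Let cZ1L1 : L1 \subset 'C(Z1).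
Proof.
apply/centsP=> u /L1P[_ u2] v /Z1P[v1 _].
by rewrite /commute [u]surjective_pairing [v]surjective_pairing u2 v1
  !pairM !(mul1g, mulg1).
Qed.

(** The choice [R = [~: S, P]] makes [S / R] central in [P / R]. *)
Let cZ1D : D \subset 'C(Z1).
Proof.
have cPS: P / R \subset 'C(S / R).
  by rewrite quotient_cents2r // commGC.
apply/centsP=> u /DP[Pu u2] v /Z1P[v1 Zv].
rewrite /commute [u]surjective_pairing [v]surjective_pairing u2 v1.
rewrite !pairM !(mul1g, mulg1); congr (_, _).
by apply: (centsP cPS) => //; rewrite mem_quotient.
Qed.

Let defX : X :=: L1 * D.
Proof. exact: norm_joinEr. Qed.

Let sZ1X : Z1 \subset X.
Proof.
apply/subsetP=> u /Z1P[u1 /morphimP[s Ns Ss u2]]; have [Ps Ls] := setIP Ss.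
have -> : u = pairg1 (coset_of R) s^-1 * delta s.
  by rewrite [u]surjective_pairing u1 u2 pairM mulVg mul1g.
rewrite /= groupM //; last by rewrite mem_gen // inE; apply/orP; right; apply/DP.
by rewrite mem_gen // inE; apply/orP; left; apply/L1P; rewrite groupV.
Qed.

Let cZ1X : X \subset 'C(Z1).
Proof. by rewrite join_subG cZ1L1. Qed.

Let tiZ1D : Z1 :&: D = 1.
Proof.
apply/trivgP/subsetP=> u /setIP[/Z1P[u1 _] /DP[_]].
by rewrite u1 morph1 => u2; rewrite [u]surjective_pairing u1 u2 inE.
Qed.

Let splitY : [splits Y, over Z1].
Proof.
apply/splitsP; exists D; apply/complP; split=> //=.
by rewrite cent_joinEr.
Qed.

(** [Z1] is a p-group, while [#|X : Y|] divides [#|L : S|], prime to [p] because [S] is Sylow in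
    [L]. *)
Let coZ1Y : coprime #|Z1| #|X : Y|.
Proof.
have defXY: X :=: Y * L1.
  apply/eqP; rewrite eqEsubset; apply/andP; split.
    by rewrite defX -(normC nL1D) mulSg ?joing_subr.
  by apply: mul_subG; rewrite ?joing_subl // join_subG sZ1X joing_subr.
have -> : #|X : Y| = #|L1 : L1 :&: Y| by rewrite defXY indexMg indexgI.
have injL: 'injm (@pairg1 gT (coset_of R)) by apply: injm_pairg1.
have sSL: S \subset L by apply: subsetIr.
have sS1Y: pairg1 (coset_of R) @* S \subset L1 :&: Y.
  rewrite subsetI morphimS //; apply/subsetP=> _ /morphimP[s _ Ss ->].
  have [Ps Ls] := setIP Ss.
  suff: pairg1 (coset_of R) s \in Y by [].
  have -> : pairg1 (coset_of R) s = delta s * (pair1g gT (coset R s))^-1.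
    by rewrite /delta (_ : _^-1 = (1^-1, (coset R s)^-1)) // pairM invg1 mulg1 mulgV.
  rewrite groupM //; first by rewrite mem_gen // inE; apply/orP; right; apply/DP.
  rewrite groupV mem_gen // inE; apply/orP; left; apply/Z1P.
  by rewrite mem_quotient.
have pZ: p.-group Z1.
  by rewrite morphim_pgroup ?quotient_pgroup ?(pgroupS _ pP) ?subsetIl.
apply: (pnat_coprime pZ); apply: pnat_dvd (indexgS _ sS1Y) _.
rewrite index_injm ?subsetT //.
have := Sylow_setI_normal nsLG sylP; rewrite setIC; by case/and3P.
Qed.

Let splitX : [splits X, over Z1].
Proof.
rewrite (Gaschutz_split _ (joing_subl Z1 D)) //.
- by rewrite /normal sZ1X cents_norm.
- by rewrite join_subG sZ1X joing_subr.
exact: subset_trans sZ1X cZ1X.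
Qed.

Lemma min_pquotient_Sylow_eq1 : P :&: L \subset 'Phi(P) -> P :&: L = 1.
Proof.
move=> sSPhi; apply/eqP; apply/idPn; change (S :!=: 1 -> False) => ntS.
(* Nilpotence of [P] makes [R] proper in a nontrivial [S], so deriving [S \subset R] is enough. *)
have: R \proper S.
  rewrite (nil_comm_properl (pgroup_nil pP)) ?subsetIl //.
  by rewrite subsetI subxx normal_norm.
case/andP=> _ /negP[].
have [W /complP[tiZW defW]] := splitsP splitX.
have sWX: W \subset X by rewrite -defW mulG_subr.
have nWX: X \subset 'N(W).
  rewrite -defW mul_subG ?normG // cents_norm // centsC.
  exact: subset_trans sWX cZ1X.
(* [L / L0] embeds in [X / W], an image of the p-group [Z1]; once [L0] is normal in [G], minimality
   gives [L0 = L], that is, [L1 \subset W]. *)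
pose L0 := (L :&: @pairg1 gT (coset_of R) @*^-1 W)%G.
have nsL0G: L0 <| G.
  apply/andP; split; first by rewrite subIset // normal_sub.
  apply/subsetP=> g; rewrite -defG => /mulsgP[a x La Px ->].
  rewrite inE; apply/subsetP=> _ /imsetP[l /setIP[Ll /morphpreP[_ Wl]] ->].
  (* This element of [X] lifts [a * x], so conjugation by it preserves [W] and induces conjugation
     by [a * x] on [L1]. *)
  have Xax : (a * x, coset R x) \in X.
    rewrite -[coset R x]mul1g -pairM groupM // mem_gen // inE; apply/orP.
      by left; apply/L1P.
    by right; apply/DP.
  rewrite inE memJ_norm //; last first.
    by rewrite (subsetP (normal_norm nsLG)) // -defG mem_mulg.
  rewrite Ll; apply/morphpreP; split; rewrite ?inE //.
  suff: pairg1 (coset_of R) (l ^ (a * x)) \in W by [].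
  have -> : pairg1 (coset_of R) (l ^ (a * x)) = (l, 1) ^ (a * x, coset R x).
    by rewrite -[RHS]/(l ^ (a * x), 1 ^ coset R x) conj1g.
  by rewrite memJ_norm // (subsetP nWX).
have sLL0: L \subset L0.
  apply: minL => //; last exact: subsetIl.
  have nL1W: L1 \subset 'N(W) := subset_trans (joing_subl L1 D) nWX.
  have pXW: p.-group (X / W).
    rewrite -defW quotientMidr; apply: quotient_pgroup; apply: morphim_pgroup.
    apply: quotient_pgroup; exact: pgroupS (subsetIl _ _) pP.
  have imL0: pairg1 (coset_of R) @* L0 = L1 :&: W.
    exact: morphim_setIpre.
  rewrite /pgroup card_quotient ?normal_norm //.
  rewrite -(Lagrange_index (normal_sub nsLG) (subsetIl _ _)) pnatM.
  rewrite -card_quotient ?normal_norm // [p.-nat _]pGL /=.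
  rewrite -(@index_injm _ _ _ (pairg1_morphism gT (coset_of R)) L L0) ?subsetT //;
    last exact: injm_pairg1.
  rewrite [X in #|_ : X|]imL0 indexgI.
  rewrite -card_quotient //; apply: pgroupS pXW.
  by rewrite quotientS ?joing_subl.
have L1W: L1 \subset W.
  apply/subsetP=> u /L1P[Lu u2]; have /setIP[_ /morphpreP[_]] := subsetP sLL0 _ Lu.
  by rewrite [u in u \in _]surjective_pairing u2.
pose M := (delta_morphism @*^-1 W)%G.
have sPM: P \subset M.
  suff sPSM: P \subset S <*> M.
    rewrite -(genGid M); rewrite (@Phi_nongen _ P M) //.
    apply/eqP; rewrite eqEsubset join_subG Phi_sub subsetIl /=.
    apply: subset_trans sPSM _.
    by rewrite join_subG joing_subr (subset_trans sSPhi) ?joing_subl.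
  apply/subsetP=> x Px.
  have: delta x \in Z1 * W.
    by rewrite defW mem_gen // inE; apply/orP; right; apply/DP.
  case/mulsgP=> z w /Z1P[z1 /morphimP[s _ Ss z2]] Ww def_dx.
  have [Ps Ls] := setIP Ss.
  rewrite -(mulKVg s x) groupM // mem_gen // inE ?Ss //; apply/orP; right.
  rewrite inE groupM ?groupV //= inE.
  have -> : delta (s^-1 * x) = pairg1 (coset_of R) s^-1 * w.
    have -> : w = z^-1 * delta x by rewrite def_dx mulKg.
    rewrite [z]surjective_pairing z1 z2 /delta.
    rewrite (_ : (_, _)^-1 = (1^-1, (coset R s)^-1)) //.
    have [Ns Nx] := (subsetP nRP s Ps, subsetP nRP x Px).
    by rewrite !pairM invg1 !mul1g morphM ?morphV ?groupV.
  by rewrite groupM // (subsetP L1W) //; apply/L1P; rewrite groupV.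
(* Both [(s, 1)] and [delta s] lie in [W], so [(1, coset R s)] lies in [Z1 :&: W = 1]. *)
apply/subsetP=> s Ss; have [Ps Ls] := setIP Ss.
have /morphpreP[_ Ws] := subsetP sPM s Ps.
have Wsv: pairg1 (coset_of R) s \in W by apply: (subsetP L1W); apply/L1P.
have: pair1g gT (coset R s) \in Z1 :&: W.
  rewrite inE; apply/andP; split; first by apply/Z1P; rewrite mem_quotient.
  have -> : pair1g gT (coset R s) = (pairg1 (coset_of R) s)^-1 * delta s.
    rewrite (_ : (pairg1 _ s)^-1 = (s^-1, 1^-1)) //.
    by rewrite /delta pairM mulVg invg1 mul1g.
  by rewrite groupM ?groupV.
rewrite tiZW => /set1P[/coset_idr]; apply; exact: subsetP nRP _ Ps.
Qed.

End Tate.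

(** For [L] minimal below [K], the trivial group [P :&: L] is Sylow in [L], so [L] has order prime
    to [p] and is the normal complement. *)
Lemma Tate_p_nilpotent (gT : finGroupType) (p : nat) (G P K : {group gT}) :
  p.-Sylow(G) P -> K <| G -> p.-group (G / K) -> P :&: K \subset 'Phi(P) ->
  p_nilpotent p G.
Proof.
move=> sylP nsKG pGK sPKPhi.
pose pquot (L : {group gT}) := (L <| G) && p.-group (G / L).
have pquotK: pquot K by rewrite /pquot nsKG.
have [L /mingroupP[/andP[nsLG pGL] minL] sLK] := mingroup_exists pquotK.
have PL1: P :&: L = 1.
  apply: (min_pquotient_Sylow_eq1 sylP nsLG pGL).
    by move=> H nsHG pGH sHL; rewrite (minL H) // /pquot nsHG.
  by apply: subset_trans sPKPhi; apply: setIS.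
have sylPL: p.-Sylow(L) (P :&: L).
  by have := Sylow_setI_normal nsLG sylP; rewrite setIC.
exists L => //; apply/and3P; split; first exact: normal_sub.
  by rewrite /pgroup -partn_eq1 ?cardG_gt0 // -(card_Hall sylPL) /= PL1 cards1.
by rewrite pnatNK -card_quotient ?normal_norm.
Qed.

(** * The equivalence, taking [T] to be the Frattini subgroup *)

Theorem corollaryC (gT : finGroupType) (p : nat) (G P : {group gT})
  (p_prime : prime p) (sylP : p.-Sylow(G) P) :
  p_nilpotent p G <->
  (p_nilpotent p 'N_G(P) /\ strongly_closed 'Phi(P) P G).
Proof.
split=> [nilG | [nilN scPhi]].
  split; first by apply: p_nilpotentS nilG; apply: subsetIl.
  exact: p_nilpotent_strongly_closed sylP (Phi_normal P) nilG.
have pP := pHall_pgroup sylP; have sPG := pHall_sub sylP.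
have nsPN: P <| 'N_G(P) := normalSG sPG.
have sylPN: p.-Sylow('N_G(P)) P.
  exact: pHall_subl (normal_sub nsPN) (subsetIl _ _) sylP.
have sNPhi := p_nilpotent_norm_comm sylPN nsPN nilN.
have nsPhi: 'Phi(P) <| P := Phi_normal P.
have fus := strongly_closed_fusion sylP nsPhi scPhi
  (fun x g => @norm_abelian_quotient_fusion _ _ _ _ _ x g sylP nsPhi sNPhi).
have cPPhi: abelian (P / 'Phi(P)).
  exact: abelem_abelian (Phi_quotient_abelem pP).
have [K nsKG /andP[pGK sPK]] := transfer_kernel sylP nsPhi cPPhi fus.
exact: Tate_p_nilpotent sylP nsKG pGK sPK.
Qed.
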